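(* Let $p \equiv 5 \pmod 8$ be prime. If $p \neq 13$, then there is a 1-factor $I$ of $K_{2p}$ such that $K_{2p} - I$ has a factorisation into $\mathrm{Cay}(\mathbb{Z}_{2p}; \pm\{1, 2, 3, 4\})$. If $p = 13$, then for no 1-factor $I$ of $K_{26}$ does $K_{26}-I$ have a factorisation into $\mathrm{Cay}(\mathbb{Z}_{26}; \pm\{1, 2, 3, 4\})$.
   Context: For a group $G$ and a subset $S \subseteq G$ not containing the identity and closed under inverses, the Cayley graph $\mathrm{Cay}(G;S)$ has vertex set $G$, with $g$ adjacent to $g s$ for each $s \in S$. $\pm\{a_1,\dots,a_s\}$ denotes $\{\pm a_1,\dots,\pm a_s\}$. $K_n - I$ is $K_n$ with the edges of a perfect matching $I$ removed. A factorisation of a graph into $H$ is a decomposition of its edge set into edge-disjoint spanning subgraphs each isomorphic to $H$. *)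

(* Defs.v *)
From HB Require Import structures.
From mathcomp Require Import all_boot all_order all_algebra all_fingroup.

Set Implicit Arguments.
Unset Strict Implicit.
Unset Printing Implicit Defensive.

Import GRing.Theory.

(* A finite simple graph is given by its adjacency relation on the finType of
   vertices, so every subgraph below is spanning. *)
Definition simple_graph (T : finType) (E : rel T) : Prop :=
  symmetric E /\ irreflexive E.

Definition spanning_subgraph (T : finType) (F E : rel T) : Prop :=
  simple_graph F /\ subrel F E.

Definition graph_iso (T U : finType) (E : rel T) (H : rel U) : Prop :=
  exists2 f : T -> U, bijective f & forall x y, H (f x) (f y) = E x y.

Definition complete_graph (n : nat) : rel 'I_n := fun x y => x != y.

Definition one_factor (T : finType) (E I : rel T) : Prop :=
  spanning_subgraph I E /\ forall x, #|[set y | I x y]| = 1.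

Definition remove_edges (T : finType) (E I : rel T) : rel T :=
  fun x y => E x y && ~~ I x y.

Definition has_factorisation (T U : finType) (E : rel T) (H : rel U) : Prop :=
  exists (k : nat) (F : 'I_k -> rel T),
    [/\ forall i, spanning_subgraph (F i) E,
        forall i, graph_iso (F i) H
      & forall x y, E x y -> exists! i, F i x y].

Definition cayley_graph (gT : finGroupType) (S : {set gT}) : rel gT :=
  fun g h => [exists s in S, h == (g * s)%g].

Definition pm_set (V : finZmodType) (A : {set V}) : {set V} :=
  A :|: [set (- a)%R | a in A].

(* The group structure on 'Z_n is the additive one, and 'Z_n is the ring of
   integers modulo n only when 1 < n. *)
Definition cay_Z_pm1234 (n : nat) : rel 'Z_n :=
  @cayley_graph 'Z_n (pm_set [set 1; 2; 3; 4]%R).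

(* Main.v *)
Require Import Defs.
From HB Require Import structures.
From mathcomp Require Import all_boot all_order all_algebra all_fingroup.
From mathcomp Require Import finfield ring lra zify.

(** Existence.  Write [p = 4 m + 1] with [m] odd, and take [bool * 'F_p] as vertex
    set, the 1-factor joining [(false, a)] to [(true, a)].  For [h <> 0], listing
    [0, h, 2 h, ...] in one layer alternately with a translate of this sequence
    in the other layer gives a copy of the fourth power of the [2 p]-cycle: it
    joins two vertices of a layer when their difference lies in [h {1, -1, 2, -2}],
    and two vertices of different layers when it lies in
    [h {x, x + 1, x + 2, x + 3}], where [x] depends on the translate.  Letting [h]
    range over the subgroup [h ^ m = 1] of index 4, these copies factorise the
    graph as soon as both quadruples meet every quartic class.  The first one
    does because 2 is not a square.  For the second, if [p >= 29] the classes of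
    3, 5, 7, 11 and 13 relative to that of 2 always allow one of 29 explicit
    progressions of 13-smooth integers, and if [p = 5] then [x = 1] works.

    Non-existence for [p = 13].  There would be three factors.  The fourth power
    of the 26-cycle has an eigenvalue near 6.35 on a vector of sum zero, and least
    eigenvalue above -3.1.  On that vector the other two factors would have to
    compensate for the first one, up to the 1-factor and the identity, which
    cancel each other in the required direction. *)

Set Implicit Arguments.
Unset Strict Implicit.
Unset Printing Implicit Defensive.

Import Order.TTheory GRing.Theory Num.Theory.
Local Open Scope ring_scope.

(** * Square roots of -1 and the quartic class of 2 *)

Lemma finField_exp_card (F : finFieldType) (n : nat) (x : F) :
  #|F| = n.+1 -> x != 0 -> x ^+ n = 1.
Proof.
move=> cardF x_neq0; apply: (mulfI x_neq0).
by rewrite -exprS -cardF expf_card mulr1.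
Qed.

(** Since [X^(2m) - 1] has at most [2m] roots, some nonzero [g] has [g^(2m) <> 1]; the square of
    [g^(2m)] is 1, so [g^m] squares to -1. *)
Lemma exists_sqrt_opp1 (F : finFieldType) (m : nat) :
  #|F| = (4 * m).+1 -> (0 < m)%N -> exists i : F, i ^+ 2 = -1.
Proof.
move=> cardF m_gt0.
have [/existsP[g /andP[g_neq0 g_exp]] | /existsPn all1] :=
    boolP [exists g : F, (g != 0) && (g ^+ (2 * m) != 1)].
  exists (g ^+ m); apply/eqP; rewrite -subr_eq0 opprK.
  have: (g ^+ m ^+ 2 - 1) * (g ^+ m ^+ 2 + 1) == 0.
    rewrite -subr_sqr expr1n -!exprM -!mulnA mulnC.
    by rewrite (finField_exp_card cardF g_neq0) subrr.
  by rewrite mulf_eq0 subr_eq0 -exprM mulnC (negPf g_exp).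
have deg_gt0 : (0 < 2 * m)%N by rewrite muln_gt0.
have := @max_poly_roots F ('X^(2 * m) - 1) (enum (predC1 (0 : F))).
have sz : size ('X^(2 * m) - 1 : {poly F}) = (2 * m).+1.
  by rewrite size_XnsubC.
rewrite -size_poly_eq0 sz enum_uniq => /(_ isT) H.
have /H/(_ isT) : all (root ('X^(2 * m) - 1)) (enum (predC1 (0 : F))).
  apply/allP=> g; rewrite mem_enum inE => g_neq0.
  rewrite rootE !hornerE; have := all1 g.
  by rewrite g_neq0 negbK => /eqP->; rewrite subrr.
rewrite -cardE cardC1 cardF /=; lia.
Qed.

(* From [(1 + i)^2 = 2 i]: raising to the power [2 m] gives [1] on the left and
   [- 2 ^ (2 m)] on the right. *)
Lemma two_exp_quarter (F : finFieldType) (m : nat) :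
  #|F| = (4 * m).+1 -> odd m -> (2%:R : F) != 0 ->
  (2%:R : F) ^+ m ^+ 2 = -1.
Proof.
move=> cardF m_odd two_neq0.
have [i i2] := exists_sqrt_opp1 cardF (odd_gt0 m_odd).
have i1_neq0 : 1 + i != 0.
  apply: contraNneq two_neq0 => i1.
  have -> : (2%:R : F) = (1 + i) * (1 - i) + (i ^+ 2 + 1) by ring.
  by rewrite i1 mul0r i2 addNr addr0.
have sq : (1 + i) ^+ 2 = 2%:R * i.
  have -> : (1 + i) ^+ 2 = 2%:R * i + (i ^+ 2 + 1) by ring.
  by rewrite i2 addNr addr0.
have := finField_exp_card cardF i1_neq0.
have -> : (4 * m = 2 * (m * 2))%N by lia.
rewrite exprM sq exprMn [i ^+ _]exprM mulrC [i ^+ m ^+ 2]exprAC i2.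
by rewrite -signr_odd m_odd expr1 mulN1r exprM => /eqP; rewrite eqr_oppLR => /eqP.
Qed.

Lemma prim_root4_sqr_opp1 (F : fieldType) (z : F) :
  (2%:R : F) != 0 -> z ^+ 2 = -1 -> 4.-primitive_root z.
Proof.
move=> two_neq0 z2.
have z4 : z ^+ 4 = 1 by rewrite (exprM z 2 2) z2 sqrrN expr1n.
have z2_neq1 : z ^+ 2 != 1 by rewrite z2 eq_sym -addr_eq0.
have [k k_prim k_dvd4] := prim_order_exists (isT : 0 < 4)%N z4.
have : k \in divisors 4 by rewrite -dvdn_divisors.
rewrite !inE => /or3P[]/eqP k_eq; move: k_prim; rewrite k_eq //.
  by move/prim_expr_order; rewrite expr1 => z1; rewrite z1 expr1n eqxx in z2_neq1.
by move/prim_expr_order => z1; rewrite z1 eqxx in z2_neq1.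
Qed.

(** * Progressions of 13-smooth integers meeting all quartic classes *)

Fixpoint monomial (R : nzRingType) (b : seq R) (v : seq nat) : R :=
  if b is x :: b' then
    if v is n :: v' then x ^+ n * monomial b' v' else 1
  else 1.

Fixpoint dotn (e v : seq nat) : nat :=
  if e is x :: e' then
    if v is n :: v' then (x * n + dotn e' v')%N else 0%N
  else 0%N.

Lemma monomial_map (R S : nzRingType) (f : {rmorphism R -> S}) b v :
  monomial (map f b) v = f (monomial b v).
Proof.
elim: b v => [|x b IHb] [|n v] //=; rewrite ?rmorph1 //.
by rewrite rmorphM rmorphXn IHb.
Qed.

Lemma monomial_exp (R : comNzRingType) (m : nat) (z : R) b e v :
  size b = size e ->
  (forall j, (j < size b)%N -> b`_j ^+ m = z ^+ nth 0%N e j) ->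
  monomial b v ^+ m = z ^+ dotn e v.
Proof.
elim: b e v => [|x b IHb] [|k e] [|n v] //=; rewrite ?expr1n // => -[sz] bE.
rewrite exprMn -exprM mulnC exprM (bE 0%N) // -exprM exprD.
by rewrite (IHb e) // => j j_lt; apply: (bE j.+1).
Qed.

Definition smooth_base : seq int := [:: -1; 2; 3; 5; 7; 11; 13].

(** Exponents over [smooth_base], that of -1 first. They recover [n] only if it is nonzero and
    13-smooth, which [smooth_apsP] checks for the terms in use. *)
Definition smooth_vec (n : int) : seq nat :=
  nat_of_bool (n < 0) :: [seq logn q `|n| | q <- [:: 2; 3; 5; 7; 11; 13]]%N.

Definition ap4 (ab : int * int) : seq int :=
  [seq ab.1 + ab.2 *+ k | k <- iota 0 4].

(* Found by computer search: whatever the quartic classes of 3, 5, 7, 11 and 13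
   relative to that of 2, one of these progressions [a + b k] meets all four
   classes. *)
Definition smooth_aps : seq (int * int) :=
  [:: (-1, 3); (-7, 9); (8, 1); (-54, 43); (-8, 19); (7, 1); (6, 1); (24, 1);
      (7, 3); (25, 1); (12, 1); (5, 2); (11, 1); (5, 1); (-2, 3); (2, 3);
      (9, 1); (6, 5); (4, 7); (2, 1); (-9, 7); (3, 5); (10, 1); (-10, 7);
      (-8, 11); (-15, 11); (-4, 3); (-3, 2); (1, 1)].

Lemma smooth_apsP :
  all (fun ab => all (fun n => monomial smooth_base (smooth_vec n) == n)
                     (ap4 ab)) smooth_aps.
Proof. by vm_compute. Qed.

(** Here [e] lists the classes of the base elements as exponents of [z = 2^m]; four distinct values
    modulo 4 are all the classes. *)
Definition meets_all_classes (e : seq nat) (t : seq (seq nat)) : bool :=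
  uniq [seq dotn e v %% 4 | v <- t]%N.

(** The leading entries 2 and 1 are forced: [(-1)^m = -1 = z^2] for odd [m], and [2^m = z]. *)
Definition meets_all_classes_has (vs : seq (seq (seq nat))) : bool :=
  let r := iota 0 4 in
  all (fun e3 => all (fun e5 => all (fun e7 => all (fun e11 => all (fun e13 =>
    has (meets_all_classes [:: 2; 1; e3; e5; e7; e11; e13]%N) vs) r) r) r) r) r.

Lemma smooth_aps_cover :
  meets_all_classes_has [seq map smooth_vec (ap4 ab) | ab <- smooth_aps].
Proof. by vm_compute. Qed.

(** Dividing a progression [a + b k] by [b] gives [x + k] with [x = a / b] and multiplies all four
    classes by one factor, so they stay distinct. *)
Lemma exists_ap_quartic_classes (F : finFieldType) (m : nat) :
    #|F| = (4 * m).+1 -> odd m ->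
    (forall q, q \in [:: 2; 3; 5; 7; 11; 13]%N -> (q%:R : F) != 0) ->
  exists2 x : F, 0 \notin [seq x + k%:R | k <- iota 0 4]
    & uniq [seq y ^+ m | y <- [seq x + k%:R | k <- iota 0 4]].
Proof.
move=> cardF m_odd q_neq0.
set z : F := 2%:R ^+ m.
have z2 : z ^+ 2 = -1 by apply: two_exp_quarter => //; apply: q_neq0.
have z_prim : 4.-primitive_root z by apply: prim_root4_sqr_opp1; rewrite ?q_neq0.
have qlog q : q \in [:: 2; 3; 5; 7; 11; 13]%N ->
    exists2 e, e \in iota 0 4 & (q%:R : F) ^+ m = z ^+ e.
  move=> /q_neq0 q0.
  have [|e ->] := @prim_rootP _ _ _ z_prim ((q%:R : F) ^+ m).
    by rewrite -exprM mulnC (finField_exp_card cardF).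
  by exists (nat_of_ord e); rewrite // mem_iota /=.
have [e3 e3_in e3E] := qlog 3%N isT.
have [e5 e5_in e5E] := qlog 5%N isT.
have [e7 e7_in e7E] := qlog 7%N isT.
have [e11 e11_in e11E] := qlog 11%N isT.
have [e13 e13_in e13E] := qlog 13%N isT.
pose e := [:: 2; 1; e3; e5; e7; e11; e13]%N.
have /hasP[_ /mapP[ab ab_in ->]] :
    has (meets_all_classes e) [seq map smooth_vec (ap4 ab) | ab <- smooth_aps].
  by have /allP/(_ _ e3_in)/allP/(_ _ e5_in)/allP/(_ _ e7_in)
    /allP/(_ _ e11_in)/allP/(_ _ e13_in) := smooth_aps_cover.
rewrite /meets_all_classes -map_comp => ab_uniq.
have chiE n : n \in ap4 ab -> (n%:~R : F) ^+ m = z ^+ (dotn e (smooth_vec n) %% 4).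
  move=> n_in; have /allP/(_ _ ab_in)/allP/(_ _ n_in)/eqP {1}<- := smooth_apsP.
  rewrite -monomial_map (@monomial_exp _ m z _ e) ?(prim_expr_mod z_prim) //.
  move=> [|[|[|[|[|[|[|//]]]]]]] _ //=.
  by rewrite z2 mulrN1z -signr_odd m_odd.
have chi_uniq : uniq [seq (n%:~R : F) ^+ m | n <- ap4 ab].
  have -> : [seq (n%:~R : F) ^+ m | n <- ap4 ab] =
      map (GRing.exp z) [seq (dotn e (smooth_vec n) %% 4)%N | n <- ap4 ab].
    by rewrite -map_comp; apply/eq_in_map => n /chiE.
  rewrite map_inj_in_uniq // => i j /mapP[a _ ->] /mapP[b _ ->].
  by move/eqP; rewrite (eq_prim_root_expr z_prim) !modn_mod => /eqP.
case: ab => a b in ab_in ab_uniq chiE chi_uniq *.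
(* If [b] vanished in [F], the four terms would coincide. *)
have b_neq0 : (b%:~R : F) != 0.
  apply: contraTneq chi_uniq => b0.
  by rewrite /= !rmorphD !rmorphMn /= b0 !mul0rn inE eqxx.
have apE : [seq a%:~R / b%:~R + k%:R | k <- iota 0 4] =
    map ( *%R (b%:~R)^-1) [seq (n%:~R : F) | n <- ap4 (a, b)].
  rewrite /ap4 -!map_comp; apply: eq_map => k /=.
  by rewrite rmorphD rmorphMn /= mulrDr mulrC -[in RHS](mulr_natr b%:~R) mulKf.
exists (a%:~R / b%:~R); rewrite apE.
(* A zero term would have [m]-th power 0, which is no power of [z]. *)
- apply/negP => /mapP[_ /mapP[n /chiE n_in ->]] /esym/eqP.
  rewrite mulf_eq0 invr_eq0 (negPf b_neq0) /= => /eqP n0; move: n_in.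
  rewrite n0 expr0n gtn_eqF ?odd_gt0 // => /esym/eqP; apply/negP.
  by rewrite !expf_neq0 // q_neq0.
- have -> : [seq y ^+ m | y <- [seq (b%:~R)^-1 * y
                                | y <- [seq (n%:~R : F) | n <- ap4 (a, b)]]] =
      map ( *%R ((b%:~R)^-1 ^+ m)) [seq (n%:~R : F) ^+ m | n <- ap4 (a, b)].
    by rewrite -!map_comp; apply: eq_map => n /=; rewrite exprMn.
  by rewrite map_inj_uniq //; apply: mulfI; rewrite expf_neq0 ?invr_neq0.
Qed.

(** * Unique division by the subgroup of index 4 *)

Lemma uniq_map_inj (T1 T2 : eqType) (f : T1 -> T2) (s : seq T1) :
  uniq (map f s) -> {in s &, injective f}.
Proof.
elim: s => //= x s IHs /andP[x_notin s_uniq] a b; rewrite !inE.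
move=> /predU1P[->|a_in] /predU1P[->|b_in] // fab.
- by rewrite fab map_f in x_notin.
- by rewrite -fab map_f in x_notin.
- exact: IHs.
Qed.

(* The four classes exhaust the quotient of the multiplicative group by its
   subgroup [h ^ m = 1]. *)
Lemma quartic_class_tiling (F : finFieldType) (m : nat) (c : seq F) (d : F) :
    #|F| = (4 * m).+1 -> (0 < m)%N -> size c = 4 -> 0 \notin c ->
    uniq [seq x ^+ m | x <- c] -> d != 0 ->
  exists! h : F, h ^+ m = 1 /\ d / h \in c.
Proof.
move=> cardF m_gt0 size_c c_neq0 c_uniq d_neq0.
have exp4 (x : F) : x != 0 -> x ^+ m ^+ 4 = 1.
  by move=> x_neq0; rewrite -exprM mulnC (finField_exp_card cardF).
have c0 x : x \in c -> x != 0 by move=> x_in; apply: contraNneq c_neq0 => <-.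
have /mapP[x x_in dx] : d ^+ m \in [seq x ^+ m | x <- c].
  (* Otherwise [d^m] and the four classes would be five roots of [X^4 - 1]. *)
  apply/negPn/negP => d_notin.
  have := @max_poly_roots F ('X^4 - 1) (d ^+ m :: [seq x ^+ m | x <- c]).
  rewrite -size_poly_eq0 size_XnsubC //= d_notin c_uniq size_map size_c.
  move=> /(_ isT) H; have // : false; apply: H => //.
  rewrite rootE !hornerE exp4 // subrr eqxx /=.
  apply/allP => _ /mapP[x /c0 x_neq0 ->].
  by rewrite rootE !hornerE exp4 // subrr.
exists (d / x); split.
  split; last by rewrite invf_div mulrCA divff ?mulr1.
  by rewrite exprMn dx -exprMn divff ?c0 // expr1n.
move=> h [h1 dh_in].
have h_neq0 : h != 0.
  by apply: contra_eq_neq h1 => ->; rewrite expr0n gtn_eqF //= eq_sym oner_neq0.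
suff -> : x = d / h by rewrite invf_div mulrCA divff ?mulr1.
by apply: (uniq_map_inj c_uniq) => //; rewrite exprMn exprVn h1 invr1 mulr1.
Qed.

(** * The Cayley graph seen in two layers, even and odd *)

Lemma mem_pm_set (V : finZmodType) (A : {set V}) (x : V) :
  (x \in pm_set A) = (x \in A) || (- x \in A).
Proof.
rewrite inE; congr (_ || _); apply/imsetP/idP => [[a a_in ->]|x_in].
  by rewrite opprK.
by exists (- x); rewrite ?opprK.
Qed.

Lemma cay_Z_pm1234E (n : nat) (u v : 'Z_n) :
  cay_Z_pm1234 u v = (v - u \in [:: 1; 2; 3; 4; -1; -2; -3; -4]).
Proof.
transitivity (v - u \in pm_set [set (1 : 'Z_n); 2; 3; 4]).
  apply/exists_inP/idP => [[s s_in /eqP->]|vu_in].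
    by rewrite FinRing.zmodMgE addrC addKr.
  by exists (v - u); rewrite // FinRing.zmodMgE addrC subrK.
by rewrite mem_pm_set !inE !eqr_oppLR !orbA.
Qed.

(** Doubling a representative embeds the integers modulo [p] as the even residues modulo [2p]. *)
Definition dbl (p : nat) (t : 'F_p) : 'Z_(2 * p) := (2 * t)%:R.

Lemma dbl_natr (p k : nat) : prime p -> dbl (k%:R : 'F_p) = (2 * k)%:R.
Proof.
move=> p_pr; have p_gt1 := prime_gt1 p_pr.
rewrite /dbl val_Fp_nat // muln_modr Zp_nat_mod //; lia.
Qed.

Lemma dblD (p : nat) (s t : 'F_p) : prime p -> dbl (s + t) = dbl s + dbl t.
Proof.
move=> p_pr; rewrite -[s]natr_Zp -[t]natr_Zp -natrD !dbl_natr //.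
by rewrite mulnDr natrD.
Qed.

Lemma dblB (p : nat) (s t : 'F_p) : prime p -> dbl (s - t) = dbl s - dbl t.
Proof. by move=> p_pr; apply/eqP; rewrite -subr_eq opprK -dblD // subrK. Qed.

Lemma dblN (p : nat) (t : 'F_p) : prime p -> dbl (- t) = - dbl t.
Proof. by move=> p_pr; rewrite -sub0r dblB // /dbl muln0 sub0r. Qed.

Definition layer_vertex (p : nat) (u : bool * 'F_p) : 'Z_(2 * p) :=
  dbl u.2 + (u.1 : nat)%:R.

Lemma val_layer_vertex (p : nat) (u : bool * 'F_p) :
  prime p -> layer_vertex u = (2 * u.2 + u.1)%N :> nat.
Proof.
move=> p_pr; have p_gt1 := prime_gt1 p_pr.
rewrite /layer_vertex /dbl -natrD val_Zp_nat ?modn_small //; last lia.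
have := ltn_ord u.2; rewrite [X in (_ < X)%N]Fp_cast //; case: u.1 => /=; lia.
Qed.

Lemma layer_vertex_inj (p : nat) : prime p -> injective (@layer_vertex p).
Proof.
move=> p_pr [e s] [d t] /(congr1 (@nat_of_ord _)).
rewrite !val_layer_vertex //= => st.
have [ed st'] : e = d /\ s = t :> nat by case: e d st => [] [] /=; lia.
by rewrite ed; congr (_, _); apply: val_inj.
Qed.

(** From odd to even, [2 (t - s) - 1 = 2 (t - s - 1) + 1], whence the correction by 1. *)
Lemma layer_vertexB (p : nat) (u v : bool * 'F_p) : prime p ->
  layer_vertex v - layer_vertex u =
  layer_vertex (v.1 != u.1, v.2 - u.2 - (u.1 && ~~ v.1 : nat)%:R).
Proof.
move=> p_pr; rewrite /layer_vertex; case: u v => [[] s] [[] t] /=;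
  rewrite !dblB // ?dbl_natr //=; ring.
Qed.

Lemma cay_layer_vertex (p : nat) (u v : bool * 'F_p) : prime p ->
  cay_Z_pm1234 (layer_vertex u) (layer_vertex v) =
  if u.1 == v.1 then v.2 - u.2 \in [:: 1; -1; 2; -2]
  else v.2 - u.2 - (u.1 : nat)%:R \in [:: 0; 1; -1; -2].
Proof.
move=> p_pr; rewrite cay_Z_pm1234E layer_vertexB //.
have -> : [:: 1; 2; 3; 4; -1; -2; -3; -4] = map (@layer_vertex p)
    [:: (true, 0); (false, 1); (true, 1); (false, 2); (true, -1); (false, -1);
        (true, -2); (false, -2)].
  rewrite /= /layer_vertex /= !dblN // (@dbl_natr p 1) // (@dbl_natr p 2) //.
  rewrite (@dbl_natr p 0) //.
  by congr [:: _; _; _; _; _; _; _; _]; ring.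
rewrite mem_map; last exact: layer_vertex_inj.
case: u v => [[] s] [[] t] /=; rewrite !inE /= !xpair_eqE /= ?subr0 ?orbF //.
all: by do ?case: (_ == _).
Qed.

(** * Copies of the Cayley graph indexed by [h] *)

(** A cross difference is always layer [true] minus layer [false], which keeps the relation
    symmetric. *)
Definition bilayer_factor (p : nat) (x h : 'F_p) : rel (bool * 'F_p) :=
  fun u v => if u.1 == v.1 then (v.2 - u.2) / h \in [:: 1; -1; 2; -2]
    else (if v.1 then v.2 - u.2 else u.2 - v.2) / h
           \in [seq x + k%:R | k <- iota 0 4].

(** Subtracting [x + 2] in layer [true] moves [x, ..., x + 3] onto [-2, ..., 1], the cross
    differences of [cay_layer_vertex]. *)
Definition twist (p : nat) (x h : 'F_p) (u : bool * 'F_p) : bool * 'F_p :=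
  (u.1, u.2 / h - (u.1 : nat)%:R * (x + 2)).

Lemma bilayer_factor_iso (p : nat) (x h : 'F_p) : prime p -> h != 0 ->
  graph_iso (bilayer_factor x h) (@cay_Z_pm1234 (2 * p)).
Proof.
move=> p_pr h_neq0; exists (@layer_vertex p \o twist x h).
  apply: inj_card_bij.
    apply: inj_comp; first exact: layer_vertex_inj.
    move=> [e s] [d t] /eqP; rewrite xpair_eqE => /andP[/eqP/= <-].
    rewrite (inj_eq (addIr _)) => /eqP st; congr (_, _).
    by apply: mulIf st; rewrite invr_eq0.
  rewrite card_prod card_bool card_Fp // card_ord Zp_cast //.
  by have := prime_gt1 p_pr; lia.
move=> [e s] [d t]; rewrite /= cay_layer_vertex // /bilayer_factor /twist /=.
case: eqVneq => [<-|ed]; first by rewrite opprB addrA subrK -mulrBl.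
have eqB (a b c d' : 'F_p) : a - b = c - d' -> (a == b) = (c == d').
  by move=> E; rewrite -subr_eq0 E subr_eq0.
case: e d ed => [] [] //= _; rewrite !inE mulrBl ?mul0r ?mul1r ?subr0.
  set a := s / h; set b := t / h.
  rewrite ![_ - 1 == _]eq_sym.
  rewrite (@eqB 0 _ (a - b) (x + 1)); last by ring.
  rewrite (@eqB 1 _ (a - b) (x + 0)); last by ring.
  rewrite (@eqB (-1) _ (a - b) (x + 2)); last by ring.
  rewrite (@eqB (-2) _ (a - b) (x + 3)); last by ring.
  by do 4!case: (_ == _).
set a := s / h; set b := t / h.
rewrite (@eqB _ 0 (b - a) (x + 2)); last by ring.
rewrite (@eqB _ 1 (b - a) (x + 3)); last by ring.
rewrite (@eqB _ (-1) (b - a) (x + 1)); last by ring.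
rewrite (@eqB _ (-2) (b - a) (x + 0)); last by ring.
by do 4!case: (_ == _).
Qed.

Lemma bilayer_factor_sym (p : nat) (x h : 'F_p) :
  symmetric (bilayer_factor x h).
Proof.
move=> [e s] [d t]; rewrite /bilayer_factor /= eq_sym.
case: eqVneq => [_|]; last by case: e d => [] [].
rewrite -opprB mulNr !inE !eqr_oppLR !opprK.
by do 4!case: (_ == _).
Qed.

Lemma Fp_natr_neq0 (p q : nat) :
  prime p -> (0 < q < p)%N -> (q%:R : 'F_p) != 0.
Proof.
move=> p_pr /andP[q_gt0 q_lt]; rewrite -val_eqE /= val_Fp_nat // modn_small //.
by rewrite -lt0n.
Qed.

Definition crossing (p : nat) : rel (bool * 'F_p) :=
  fun u v => (u.1 != v.1) && (u.2 == v.2).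

(** Equal second components have difference 0, which lies in neither quadruple. *)
Lemma bilayer_factor_neq (p : nat) (x h : 'F_p) (u v : bool * 'F_p) :
    prime p -> (2 < p)%N -> 0 \notin [seq x + k%:R | k <- iota 0 4] ->
  bilayer_factor x h u v -> (u != v) && ~~ crossing u v.
Proof.
move=> p_pr p_gt2 x_neq0 uv.
have [e21|e21] := eqVneq u.2 v.2; last first.
  rewrite /crossing (negPf e21) andbF andbT.
  by apply: contraNneq e21 => ->.
case/negP: x_neq0; move: uv; rewrite /bilayer_factor e21 !subrr if_same mul0r.
case: ifP => // _; rewrite !inE !(eq_sym 0) oppr_eq0 oner_eq0 oppr_eq0 /= orbb.
by rewrite (negPf (@Fp_natr_neq0 p 2 p_pr p_gt2)).
Qed.

Lemma exists_unique_bilayer_factor (p m : nat) (x : 'F_p) (u v : bool * 'F_p) :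
    prime p -> p = (4 * m).+1 -> odd m ->
    0 \notin [seq x + k%:R | k <- iota 0 4] ->
    uniq [seq y ^+ m | y <- [seq x + k%:R | k <- iota 0 4]] ->
    u != v -> ~~ crossing u v ->
  exists! h : 'F_p, h ^+ m = 1 /\ bilayer_factor x h u v.
Proof.
move=> p_pr pE m_odd x_neq0 x_uniq.
have cardF : #|'F_p| = (4 * m).+1 by rewrite card_Fp.
have m_gt0 := odd_gt0 m_odd.
have two_neq0 : (2 : 'F_p) != 0 by apply: (@Fp_natr_neq0 p 2) => //; lia.
have z2 := two_exp_quarter cardF m_odd two_neq0.
rewrite /bilayer_factor /crossing; case: u v => [e s] [d t] /=.
rewrite xpair_eqE; case: eqVneq => [_ st _|_ _ st] /=.
  apply: (quartic_class_tiling cardF m_gt0) => //.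
  - by rewrite !inE !(eq_sym 0) !oppr_eq0 oner_eq0 orbb.
  (* With [z = 2^m] and [m] odd, the classes of 1, -1, 2, -2 are [z^0, z^2, z^1, z^3]. *)
  - have -> : [seq y ^+ m | y <- [:: 1; -1; 2; -2]] =
        map (GRing.exp (2 ^+ m : 'F_p)) [:: 0; 2; 1; 3]%N.
      rewrite /= expr0 expr1 (exprS _ 2) z2 mulrN1 expr1n.
      by rewrite -[-2]mulN1r exprMn -signr_odd m_odd mulN1r.
    rewrite map_inj_in_uniq // => i j i_in j_in /eqP.
    rewrite (eq_prim_root_expr (prim_root4_sqr_opp1 two_neq0 z2)).
    rewrite !modn_small; first by move/eqP.
      by move: j_in; rewrite !inE => /or4P[]/eqP->.
    by move: i_in; rewrite !inE => /or4P[]/eqP->.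
  - by rewrite subr_eq0 eq_sym.
apply: (quartic_class_tiling cardF m_gt0) => //.
by case: d; rewrite subr_eq0 // eq_sym.
Qed.

(** * The factorisation for [p <> 13] *)

Lemma exists_cay_factorisation (p m : nat) (x : 'F_p) :
    prime p -> p = (4 * m).+1 -> odd m ->
    0 \notin [seq x + k%:R | k <- iota 0 4] ->
    uniq [seq y ^+ m | y <- [seq x + k%:R | k <- iota 0 4]] ->
  exists2 I : rel 'I_(2 * p),
    one_factor (@complete_graph (2 * p)) I
    & has_factorisation (remove_edges (@complete_graph (2 * p)) I)
        (@cay_Z_pm1234 (2 * p)).
Proof.
move=> p_pr pE m_odd x_neq0 x_uniq.
have p_gt2 : (2 < p)%N by have := odd_gt0 m_odd; lia.
have cardT : #|{: bool * 'F_p}| = (2 * p)%N.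
  by rewrite card_prod card_bool card_Fp.
pose g (i : 'I_(2 * p)) : bool * 'F_p := enum_val (cast_ord (esym cardT) i).
have g_bij : bijective g.
  apply: inj_card_bij; last by rewrite card_ord cardT.
  by move=> i j /enum_val_inj /cast_ord_inj.
have g_inj := bij_inj g_bij.
exists (fun i j => crossing (g i) (g j)).
  split; first split.
  - split=> [i j|i]; rewrite /crossing; last by rewrite eqxx.
    by rewrite eq_sym [_.2 == _]eq_sym.
  - by move=> i j; apply: contraTneq => ->; rewrite /crossing eqxx.
  move=> i; have [g' gK g'K] := g_bij.
  apply/eqP/cards1P; exists (g' (~~ (g i).1, (g i).2)); apply/setP=> j.
  rewrite !inE -(inj_eq g_inj) g'K /crossing -pair_eqE /=.
  by rewrite [_.2 == _]eq_sym; case: (g i).1 (g j).1 => [] [].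
(* One factor for each element of the subgroup of index 4. *)
pose H := [set h : 'F_p | h ^+ m == 1].
exists #|H|, (fun k i j => bilayer_factor x (enum_val k) (g i) (g j)).
have neqP h i j : bilayer_factor x h (g i) (g j) ->
    remove_edges (@complete_graph (2 * p))
      (fun i j => crossing (g i) (g j)) i j.
  by move/(bilayer_factor_neq p_pr p_gt2 x_neq0); rewrite (inj_eq g_inj).
split=> [k|k|i j /andP[ij ij_cross]].
- split; last by move=> i j; apply: neqP.
  split=> [i j|i]; first exact: bilayer_factor_sym.
  by apply: contraTF isT => /neqP; rewrite /remove_edges /complete_graph eqxx.
- have h_neq0 : enum_val k != 0 :> 'F_p.
    have := enum_valP k; rewrite inE; apply: contraTneq => ->.
    by rewrite expr0n gtn_eqF ?odd_gt0 //= eq_sym oner_eq0.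
  have [f f_bij fE] := bilayer_factor_iso x p_pr h_neq0.
  by exists (f \o g); [apply: bij_comp | move=> i j; rewrite /= fE].
have [|h [[h1 ij_h] h_uniq]] :=
  exists_unique_bilayer_factor p_pr pE m_odd x_neq0 x_uniq _ ij_cross.
  by rewrite (inj_eq g_inj).
have h_in : h \in H by rewrite inE h1.
exists (enum_rank_in h_in h); split; first by rewrite enum_rankK_in.
move=> k ij_k; apply: enum_val_inj; rewrite enum_rankK_in //.
apply: h_uniq; split=> //.
by have := enum_valP k; rewrite inE => /eqP.
Qed.

Lemma exists_cay_factorisation_5mod8 (p : nat) :
    prime p -> p = 5 %[mod 8] -> p <> 13 ->
  exists2 I : rel 'I_(2 * p),
    one_factor (@complete_graph (2 * p)) I
    & has_factorisation (remove_edges (@complete_graph (2 * p)) I)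
        (@cay_Z_pm1234 (2 * p)).
Proof.
move=> p_pr p_mod8 p_neq13.
have [m pE m_odd] : exists2 m, p = (4 * m).+1 & odd m.
  exists (2 * (p %/ 8)).+1; last by rewrite /= mul2n odd_double.
  by rewrite {1}(divn_eq p 8) p_mod8; lia.
have [x x_neq0 x_uniq] : exists2 x : 'F_p,
    0 \notin [seq x + k%:R | k <- iota 0 4]
    & uniq [seq y ^+ m | y <- [seq x + k%:R | k <- iota 0 4]].
  have [p5|p_neq5] := eqVneq p 5%N.
    (* For [m = 1] the classes are the elements themselves, and 1, 2, 3, 4 are distinct modulo 5. *)
    have m1 : m = 1%N by lia.
    by rewrite p5 m1; exists 1.
  apply: exists_ap_quartic_classes => //; first by rewrite card_Fp.
  have p_ge : (13 < p)%N by lia.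
  move=> q q_in; apply: Fp_natr_neq0 => //.
  by move: q_in; rewrite !inE => /or4P[|||/or3P[]] /eqP->; lia.
exact: exists_cay_factorisation x_neq0 x_uniq.
Qed.

(** * Quadratic forms of adjacency matrices *)

Definition quad (T : finType) (E : rel T) (y : T -> int) : int :=
  \sum_u \sum_v (E u v)%:R * (y u * y v).

Definition sqnorm (T : finType) (y : T -> int) : int := \sum_u y u ^+ 2.

Lemma factorisation_indicator (T : finType) (k : nat) (F : 'I_k -> rel T)
    (E : rel T) (R : pzRingType) (u v : T) :
    (forall i, subrel (F i) E) ->
    (forall x y, E x y -> exists! i, F i x y) ->
  (E u v)%:R = \sum_i (F i u v)%:R :> R.
Proof.
move=> FE uniqF; have [uv|/negbTE uv] := boolP (E u v).
  have [i [Fi i_uniq]] := uniqF _ _ uv.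
  rewrite (bigD1 i) //= Fi big1 ?addr0 // => j j_neq.
  by case: (boolP (F j u v)) => // /i_uniq ij; rewrite ij eqxx in j_neq.
rewrite big1 // => i _; case: (boolP (F i u v)) => // /FE.
by rewrite uv.
Qed.

Lemma quad_factorisation (T : finType) (k : nat) (F : 'I_k -> rel T)
    (E : rel T) (y : T -> int) :
    (forall i, subrel (F i) E) ->
    (forall x y, E x y -> exists! i, F i x y) ->
  quad E y = \sum_i quad (F i) y.
Proof.
move=> FE uniqF; rewrite /quad [RHS]exchange_big; apply: eq_bigr => u _.
rewrite [RHS]exchange_big; apply: eq_bigr => v _.
by rewrite (factorisation_indicator _ u v FE uniqF) mulr_suml.
Qed.

Lemma quad_iso (T U : finType) (E : rel T) (H : rel U) (f : T -> U)
    (y : U -> int) :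
    bijective f -> (forall u v, H (f u) (f v) = E u v) ->
  quad E (y \o f) = quad H y.
Proof.
move=> f_bij fE; rewrite /quad (reindex f) /=; last exact: onW_bij.
apply: eq_bigr => u _; rewrite [RHS](reindex f) /=; last exact: onW_bij.
by apply: eq_bigr => v _; rewrite fE.
Qed.

Lemma sqnorm_bij (T U : finType) (f : T -> U) (y : U -> int) :
  bijective f -> sqnorm (y \o f) = sqnorm y.
Proof.
by move=> f_bij; rewrite /sqnorm [RHS](reindex f) //=; apply: onW_bij.
Qed.

Lemma one_factor_sum (T : finType) (E I : rel T) (R : pzRingType) (u : T) :
  one_factor E I -> \sum_v (I u v)%:R = 1 :> R.
Proof.
move=> [_ /(_ u) I1]; transitivity (#|[set v | I u v]|%:R : R).
  rewrite -sum1dep_card natr_sum [RHS]big_mkcond; apply: eq_bigr => v _.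
  by case: (I u v).
by rewrite I1.
Qed.

(** Expand the nonnegative sum of [(y u + y v)^2] over the pairs in [I]: every vertex has exactly
    one partner. *)
Lemma one_factor_quad_ge (T : finType) (E I : rel T) (y : T -> int) :
  one_factor E I -> - sqnorm y <= quad I y.
Proof.
move=> I1; have I_sym : symmetric I by case: I1 => [[[]]].
have Iu (u : T) : \sum_v (I u v)%:R * y u ^+ 2 = y u ^+ 2.
  by rewrite -mulr_suml (one_factor_sum _ _ I1) mul1r.
have: 0 <= \sum_u \sum_v (I u v)%:R * (y u + y v) ^+ 2.
  by do 2![apply: sumr_ge0 => ? _]; rewrite mulr_ge0 ?ler0n ?sqr_ge0.
suff -> : \sum_u \sum_v (I u v)%:R * (y u + y v) ^+ 2 =
    sqnorm y + sqnorm y + quad I y + quad I y by lia.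
transitivity (\sum_u \sum_v ((I u v)%:R * y u ^+ 2 + (I u v)%:R * y v ^+ 2 +
    (I u v)%:R * (y u * y v) + (I u v)%:R * (y u * y v))).
  by do 2![apply: eq_bigr => ? _]; ring.
under eq_bigr do rewrite !big_split /=.
rewrite !big_split /=; congr (_ + _ + _ + _); first exact: eq_bigr.
rewrite exchange_big; apply: eq_bigr => u _ /=.
by under eq_bigr do rewrite I_sym.
Qed.

(** The adjacency matrix is the all-ones matrix minus the identity and that of [I]. *)
Lemma quad_complete_remove (n : nat) (I : rel 'I_n) (y : 'I_n -> int) :
    one_factor (@complete_graph n) I ->
  quad (remove_edges (@complete_graph n) I) y =
  (\sum_u y u) ^+ 2 - sqnorm y - quad I y.
Proof.
move=> [[[_ I_irr] _] _].
transitivity (\sum_u \sum_v (y u * y v - (u == v)%:R * (y u * y v)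
                              - (I u v)%:R * (y u * y v))).
  apply: eq_bigr => u _; apply: eq_bigr => v _.
  rewrite /remove_edges /complete_graph.
  by have [<-|_] := eqVneq u v; rewrite ?I_irr; case: (I u v) => /=; ring.
under eq_bigr do rewrite !sumrB.
rewrite !sumrB; congr (_ - _ - _).
  by rewrite expr2 mulr_suml; apply: eq_bigr => u _; rewrite mulr_sumr.
apply: eq_bigr => u _; rewrite (bigD1 u) //= eqxx mul1r big1 ?addr0 //.
by move=> v /negbTE; rewrite eq_sym => ->; rewrite mul0r.
Qed.

(** * Autocorrelations and eigenvalue estimates for the Cayley graph *)

Definition corr (n : nat) (y : 'Z_n -> int) (d : 'Z_n) : int :=
  \sum_u y u * y (u + d).

Lemma sum_corr (n : nat) (y : 'Z_n -> int) (a b : 'Z_n) :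
  \sum_u y (u + a) * y (u + b) = corr y (b - a).
Proof.
rewrite /corr [RHS](reindex_inj (addIr a)); apply: eq_bigr => u _.
by rewrite -addrA [a + _]addrC subrK.
Qed.

Lemma corrN (n : nat) (y : 'Z_n -> int) (d : 'Z_n) : corr y (- d) = corr y d.
Proof.
rewrite -[- d]sub0r -sum_corr; apply: eq_bigr => u _.
by rewrite addr0 mulrC.
Qed.

Lemma sum_cay (u : 'Z_26) (y : 'Z_26 -> int) :
  \sum_v (cay_Z_pm1234 u v)%:R * y v =
  \sum_(s <- [:: 1; 2; 3; 4; -1; -2; -3; -4]) y (u + s).
Proof.
have L_uniq : uniq ([:: 1; 2; 3; 4; -1; -2; -3; -4] : seq 'Z_26).
  by vm_compute.
rewrite (big_uniq _ L_uniq) [RHS]big_mkcond (reindex_inj (addrI u)) /=.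
apply: eq_bigr => s _; rewrite cay_Z_pm1234E addrC addKr mulr_natl mulrb.
by [].
Qed.

Lemma quad_cay (y : 'Z_26 -> int) :
  quad (@cay_Z_pm1234 26) y =
  2 * (corr y 1 + corr y 2 + corr y 3 + corr y 4).
Proof.
transitivity (\sum_(s <- [:: 1; 2; 3; 4; -1; -2; -3; -4]) corr y s).
  rewrite [RHS]exchange_big; apply: eq_bigr => u _.
  rewrite -mulr_sumr -sum_cay mulr_sumr.
  by apply: eq_bigr => v _; rewrite mulrCA.
by rewrite !big_cons big_nil !corrN; ring.
Qed.

(* The sum of squares of [8 y_u + y_(u+1) + 3 y_(u+2) + 4 y_(u+3) + 5 y_(u+4)]
   has autocorrelations [115, 43, 43, 37, 40], close to a multiple of
   [133/43, 1, 1, 1, 1]; the defect is absorbed by [(y_u + y_(u+d))^2]. *)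
Lemma quad_cay_ge (y : 'Z_26 -> int) :
  - (133 * sqnorm y) <= 43 * quad (@cay_Z_pm1234 26) y.
Proof.
have corr0 : corr y 0 = sqnorm y.
  by apply: eq_bigr => u _; rewrite addr0 expr2.
have corr_ge d : 0 <= corr y 0 + corr y d.
  have: 0 <= \sum_u (y (u + 0) + y (u + d)) ^+ 2.
    by apply: sumr_ge0 => u _; apply: sqr_ge0.
  have -> : \sum_u (y (u + 0) + y (u + d)) ^+ 2 =
      \sum_u (y (u + 0) * y (u + 0) + 2 * (y (u + 0) * y (u + d)) +
              y (u + d) * y (u + d)) by apply: eq_bigr => u _; ring.
  by rewrite !big_split /= -mulr_sumr !sum_corr !subrr subr0; lra.
have: 0 <= \sum_u (8 * y (u + 0) + y (u + 1) + 3 * y (u + 2) + 4 * y (u + 3)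
                   + 5 * y (u + 4)) ^+ 2.
  by apply: sumr_ge0 => u _; apply: sqr_ge0.
have -> : \sum_u (8 * y (u + 0) + y (u + 1) + 3 * y (u + 2) + 4 * y (u + 3)
                   + 5 * y (u + 4)) ^+ 2 =
  115 * corr y 0 + 86 * corr y 1 + 86 * corr y 2 + 74 * corr y 3 + 80 * corr y 4.
  pose c (a b : 'Z_26) u := y (u + a) * y (u + b).
  transitivity (\sum_u (64 * c 0 0 u + 1 * c 1 1 u + 9 * c 2 2 u + 16 * c 3 3 u
    + 25 * c 4 4 u + 16 * c 0 1 u + 48 * c 0 2 u + 64 * c 0 3 u + 80 * c 0 4 u
    + 6 * c 1 2 u + 8 * c 1 3 u + 10 * c 1 4 u + 24 * c 2 3 u + 30 * c 2 4 u
    + 40 * c 3 4 u)).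
    by apply: eq_bigr => u _; rewrite /c; ring.
  rewrite !big_split /= -!mulr_sumr /c !sum_corr !subrr !subr0.
  have -> : 2 - 1 = 1 :> 'Z_26 by apply: val_inj.
  have -> : 3 - 1 = 2 :> 'Z_26 by apply: val_inj.
  have -> : 4 - 1 = 3 :> 'Z_26 by apply: val_inj.
  have -> : 3 - 2 = 1 :> 'Z_26 by apply: val_inj.
  have -> : 4 - 2 = 2 :> 'Z_26 by apply: val_inj.
  have -> : 4 - 3 = 1 :> 'Z_26 by apply: val_inj.
  ring.
(* Adding 12 times the bound for 3 and 6 times that for 4 turns the coefficients 115, 74, 80 into
   133, 86, 86. *)
rewrite quad_cay -corr0; have := corr_ge 3; have := corr_ge 4; lra.
Qed.

(* A triangular wave, close to the eigenvector [cos (2 pi u / 26)]. *)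
Definition wave (u : 'Z_26) : int :=
  nth 0 [:: 5; 5; 4; 3; 2; 1; 0; -1; -2; -3; -4; -5; -5; -5; -5; -4; -3; -2; -1;
            0; 1; 2; 3; 4; 5; 5] u.

Lemma sum_wave : \sum_u wave u = 0.
Proof. by rewrite !big_ord_recl big_ord0; vm_compute. Qed.

Lemma sqnorm_wave : sqnorm wave = 320.
Proof. by rewrite /sqnorm !big_ord_recl big_ord0; vm_compute. Qed.

Lemma quad_cay_wave : quad (@cay_Z_pm1234 26) wave = 2020.
Proof.
by rewrite quad_cay /corr !big_ord_recl !big_ord0; vm_compute.
Qed.

(** * Non-existence for [p = 13] *)

(** Compare degrees at one vertex: 24 in the whole graph, 8 in each factor. *)
Lemma factorisation_26_card (k : nat) (F : 'I_k -> rel 'I_26) (I : rel 'I_26) :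
    one_factor (@complete_graph 26) I ->
    (forall i, spanning_subgraph (F i) (remove_edges (@complete_graph 26) I)) ->
    (forall i, graph_iso (F i) (@cay_Z_pm1234 26)) ->
    (forall x y, remove_edges (@complete_graph 26) I x y ->
      exists! i, F i x y) ->
  k = 3.
Proof.
move=> I1 Fsub Fiso Funiq; have u : 'I_26 := ord0.
have [[[_ I_irr] _] _] := I1.
have FE i : subrel (F i) (remove_edges (@complete_graph 26) I).
  by case: (Fsub i).
have degE : \sum_v (remove_edges (@complete_graph 26) I u v)%:R = 24 :> int.
  transitivity (\sum_v (1 - (u == v)%:R - (I u v)%:R) : int).
    apply: eq_bigr => v _; rewrite /remove_edges /complete_graph.
    by have [<-|_] := eqVneq u v; rewrite ?I_irr //; case: (I u v).
  rewrite !sumrB (one_factor_sum _ _ I1) sumr_const card_ord.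
  by rewrite (bigD1 u) //= eqxx big1 // => v /negbTE; rewrite eq_sym => ->.
have degF i : \sum_v (F i u v)%:R = 8 :> int.
  have [f f_bij fE] := Fiso i.
  transitivity (\sum_(s <- [:: 1; 2; 3; 4; -1; -2; -3; -4 : 'Z_26]) 1 : int).
    rewrite -(sum_cay (f u) (fun=> 1)) [RHS](reindex f) /=; last exact: onW_bij.
    by apply: eq_bigr => v _; rewrite fE mulr1.
  by rewrite !big_cons big_nil.
move: degE; under eq_bigr do rewrite (factorisation_indicator _ _ _ FE Funiq).
rewrite exchange_big /=; under eq_bigr do rewrite degF.
rewrite sumr_const card_ord; lia.
Qed.

(* The wave carried by the first factor has Rayleigh quotient [2020 / 320] for
   that factor and at least [- 133 / 43] for each of the two others, while on
   the whole graph its quadratic form is nonpositive. *)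
Lemma no_factorisation_26 (I : rel 'I_26) :
  one_factor (@complete_graph 26) I ->
  ~ has_factorisation (remove_edges (@complete_graph 26) I)
      (@cay_Z_pm1234 26).
Proof.
move=> I1 [k [F [Fsub Fiso Funiq]]].
have k3 := factorisation_26_card I1 Fsub Fiso Funiq; subst k.
have FE i : subrel (F i) (remove_edges (@complete_graph 26) I).
  by case: (Fsub i).
have [f f_bij fE] := Fiso ord0.
pose y := wave \o f.
have y_norm : sqnorm y = 320 by rewrite sqnorm_bij // sqnorm_wave.
have y_sum : \sum_u y u = 0.
  transitivity (\sum_u wave u); last exact: sum_wave.
  by rewrite [RHS](reindex f) //; apply: onW_bij.
have quad0 : quad (F ord0) y = 2020 by rewrite (quad_iso _ f_bij fE) quad_cay_wave.
(* The bound is transported along the factor's own isomorphism [g], since it holds for every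
   vector. *)
have quad_ge i : - (133 * 320) <= 43 * quad (F i) y.
  have [g [g' gK g'K] gE] := Fiso i.
  have g_bij : bijective g by exists g'.
  have yE : y =1 (y \o g') \o g by move=> u; rewrite /= gK.
  have -> : quad (F i) y = quad (@cay_Z_pm1234 26) (y \o g').
    rewrite -(quad_iso _ g_bij gE); apply: eq_bigr => u _.
    by apply: eq_bigr => v _; rewrite -!yE.
  rewrite -y_norm -(@sqnorm_bij _ _ g') ?quad_cay_ge //.
  by exists g.
have := quad_complete_remove y I1.
rewrite y_sum y_norm (quad_factorisation y FE Funiq) !big_ord_recl big_ord0 quad0.
(* The three forms sum to [- 320 - quad I y <= 0], yet to at least [2020 - 2 * 133 * 320 / 43],
   which exceeds 40. *)
have := one_factor_quad_ge y I1; rewrite y_norm.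
have := quad_ge (lift ord0 ord0); have := quad_ge (lift ord0 (lift ord0 ord0)).
lra.
Qed.

Local Close Scope ring_scope.

Theorem theorem11 (p : nat) (p_prime : prime p) (p_mod8 : p = 5 %[mod 8]) :
  (p <> 13 ->
     exists2 I : rel 'I_(2 * p),
       one_factor (@complete_graph (2 * p)) I
     & has_factorisation (remove_edges (@complete_graph (2 * p)) I)
         (@cay_Z_pm1234 (2 * p))) /\
  (p = 13 ->
     forall I : rel 'I_26,
       one_factor (@complete_graph 26) I ->
       ~ has_factorisation (remove_edges (@complete_graph 26) I)
           (@cay_Z_pm1234 26)).
Proof.
split=> [p_neq13 | _ I I1]; first exact: exists_cay_factorisation_5mod8.
exact: no_factorisation_26 I1.
Qed.
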